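(* There exists a graded invertible linear map $\Psi:T((\mathbb{R}^d))\to T((\mathbb{R}^d))$ such that for every smooth path $Y=(A,X)$ in $\mathbb{R}^d$, all times $s<t$ in its time interval, and every word $w\in\mathcal{W}_{\mathcal{A}}$, one has $$\langle w,\Psi(\mathrm{Sig}(Y)_{s,t})\rangle=\langle w_k,\mathrm{Sig}(X)_{s,t}\rangle\int_{s<t_1<\cdots<t_k<t}\ \prod_{j=1}^{k}\langle w_{j-1},\mathrm{Sig}(X)_{s,t_j}\rangle\,\mathrm{d}A^{i_j}_{t_j},$$ where $w=w_0i_1w_1\cdots i_kw_k$ is the unique decomposition with $w_0,\dots,w_k\in\mathcal{W}_{\mathcal{A}''}$ and $i_1,\dots,i_k\in\mathcal{A}'$.
   Context: $\mathcal{A}$ is an alphabet with $d$ letters, partitioned as $\mathcal{A}=\mathcal{A}'\,\dot\cup\,\mathcal{A}''$ into two nonempty sets. For an alphabet $\mathcal{B}$, $\mathcal{W}_{\mathcal{B}}$ is the set of words over $\mathcal{B}$, including the empty word $\emptyset$. $T((\mathbb{R}^d))=\prod_{n\ge0}(\mathbb{R}^d)^{\otimes n}$ is the space of formal series $\sum_{w\in\mathcal{W}_{\mathcal A}}a_we_w$ with $e_{i_1\cdots i_n}=e_{i_1}\otimes\cdots\otimes e_{i_n}$, $e_\emptyset=1$; for a word $w$, $\langle w,\cdot\rangle$ denotes the coefficient of $e_w$. A linear map $\ell$ on $T((\mathbb{R}^d))$ is graded if it is of the form $\ell(\mathbf a)=\sum_w e_w\langle \ell_w,\mathbf a\rangle$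 where each $\ell_w$ is a finite linear combination of words of length $|w|$; in particular it preserves tensor levels. A path $Y$ in $\mathbb{R}^d$ has components $Y^a$, $a\in\mathcal{A}$; write $A=(Y^{a})_{a\in\mathcal{A}'}$, $X=(Y^{b})_{b\in\mathcal{A}''}$. The signature is $\langle i_1\cdots i_n,\mathrm{Sig}(Y)_{s,t}\rangle=\int_{s<t_1<\cdots<t_n<t}\mathrm{d}Y^{i_1}_{t_1}\cdots\mathrm{d}Y^{i_n}_{t_n}$, $\langle\emptyset,\mathrm{Sig}(Y)_{s,t}\rangle=1$; for words over $\mathcal{A}''$, $\langle w,\mathrm{Sig}(X)_{s,t}\rangle$ is defined in the same way using the components of $X$. *)

(* Defs.v *)
From HB Require Import structures.
From mathcomp Require Import all_boot all_order all_algebra.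
From mathcomp Require Import all_classical all_reals all_analysis.
Set Implicit Arguments.
Unset Strict Implicit.
Unset Printing Implicit Defensive.
Import Order.TTheory GRing.Theory Num.Theory.
Import numFieldNormedType.Exports.
Local Open Scope ring_scope.

(* T((R^d)), the d letters being the elements of L: a series is identified with
   its coefficient function, so that <w, a> is a w. The lmodType structure is
   the pointwise one. *)
Notation tensor_series R L := (seq L -> R^o).

Definition graded (R : realType) (L : finType)
    (ell : tensor_series R L -> tensor_series R L) : Prop :=
  exists c : seq L -> seq L -> R, forall (a : tensor_series R L) (w : seq L),
    ell a w = \sum_(v : (size w).-tuple L) c w v * a v.

(* C^oo on an arbitrary interval I: F n is the n-th derivative of f on I, the
   difference quotients being taken inside I, hence one-sided at an endpoint
   of I. The values of f outside I are irrelevant. *)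
Definition smooth_on (R : realType) (I : interval R) (f : R -> R) : Prop :=
  exists F : nat -> R -> R,
    {in I, F 0%N =1 f} /\
    forall n, {in I, forall x,
      ((F n y - F n x) / (y - x) @[y --> within [set` I] x^'] -->
         F n.+1 x)%classic}.

(* The integral of G (t_1, ..., t_n) dt_1 ... dt_n over
   s < t_1 < ... < t_n < t, the outermost variable being t_n. *)
Fixpoint simplex_integral (R : realType) (n : nat) (s t : R)
    (G : seq R -> R) : R :=
  if n is m.+1 then
    \int[lebesgue_measure]_(u in `]s, t[%classic)
      simplex_integral m s u (fun ts => G (rcons ts u))
  else G [::].

(* For a smooth path, dY^a_u is derive1 (Y a) u du. *)
Definition Sig (R : realType) (L : Type) (Y : L -> R -> R) (s t : R) :
    tensor_series R L :=
  fun w => simplex_integral (size w) s t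
    (fun ts => \prod_(q <- zip w ts) derive1 (Y q.1) q.2).

(* The word w_0 i_1 w_1 ... i_k w_k, for bs = [:: (w_0, i_1); ...;
   (w_(k-1), i_k)]; the words w_j are over A2 and the letters i_j in A1. *)
Definition block_word (L : finType) (A1 A2 : {set L})
    (bs : seq (seq {x | x \in A2} * {x | x \in A1}))
    (wk : seq {x | x \in A2}) : seq L :=
  flatten [seq rcons [seq val x | x <- b.1] (val b.2) | b <- bs]
    ++ [seq val x | x <- wk].

Lemma block_word_exists (L : finType) (A1 A2 : {set L}) (w : seq L) :
  A1 :|: A2 = [set: L] -> exists bs wk, w = @block_word L A1 A2 bs wk.
Proof.
move=> cov; elim: w => [|x w [bs [wk ->]]]; first by exists [::], [::].
have : x \in A1 :|: A2 by rewrite cov inE.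
rewrite inE; have [xA1 _|_ /= xA2] := boolP (x \in A1).
  by exists (([::], exist _ x xA1) :: bs), wk.
case: bs => [|[u i] bs]; first by exists [::], (exist _ x xA2 :: wk).
by exists ((exist _ x xA2 :: u, i) :: bs), wk.
Qed.

Lemma block_word_inj (L : finType) (A1 A2 : {set L})
    (bs bs' : seq (seq {x | x \in A2} * {x | x \in A1}))
    (wk wk' : seq {x | x \in A2}) :
  [disjoint A1 & A2] ->
  block_word bs wk = block_word bs' wk' -> bs = bs' /\ wk = wk'.
Proof.
move=> dis.
have neq (i : {x | x \in A1}) (x : {x | x \in A2}) : val i = val x -> False.
  move=> e; have := disjointFr dis (valP i).
  by rewrite e (valP x).
move e : (block_word bs wk) => w; elim: w bs wk bs' wk' e => [|x w IH].
  by case=> [|[[|? ?] ?] ?] [|? ?] // [|[[|? ?] ?] ?] [|? ?].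
have cases ds vk : @block_word L A1 A2 ds vk = x :: w ->
  [\/ exists z vk', [/\ ds = [::], vk = z :: vk', val z = x
        & @block_word L A1 A2 [::] vk' = w],
      exists i ds', [/\ ds = ([::], i) :: ds', val i = x
        & block_word ds' vk = w]
    | exists z u i ds', [/\ ds = (z :: u, i) :: ds', val z = x
        & block_word ((u, i) :: ds') vk = w]].
  case: ds => [|[[|z u] i] ds].
  - by case: vk => // z vk [? ?]; constructor 1; exists z, vk.
  - by case=> ? ?; constructor 2; exists i, ds.
  - by case=> ? ?; constructor 3; exists z, u, i, ds.
move=> bs wk bs' wk' c1 c2.
case: (cases _ _ c1) => [[z [v [-> -> ez e]]]|[i [ds [-> ei e]]]|[z [u [i [ds [-> ez e]]]]]];
case: (cases _ _ (esym c2)) => [[z' [v' [-> -> ez' e']]]|[i' [ds' [-> ei' e']]]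
  |[z' [u' [i' [ds' [-> ez' e']]]]]].
- have [_ ->] := IH _ _ _ _ e (esym e').
  by rewrite (val_inj (etrans ez (esym ez'))).
- by case: (neq _ _ (etrans ei' (esym ez))).
- by have [] := IH _ _ _ _ e (esym e').
- by case: (neq _ _ (etrans ei (esym ez'))).
- have [-> ->] := IH _ _ _ _ e (esym e').
  by rewrite (val_inj (etrans ei (esym ei'))).
- by case: (neq _ _ (etrans ei (esym ez'))).
- by have [] := IH _ _ _ _ e (esym e').
- by case: (neq _ _ (etrans ei' (esym ez))).
- have [[-> -> ->] ->] := IH _ _ _ _ e (esym e').
  by rewrite (val_inj (etrans ez (esym ez'))).
Qed.

(* Main.v *)
Require Import Defs.
From HB Require Import structures.
From mathcomp Require Import all_boot all_order all_algebra.
From mathcomp Require Import all_classical all_reals all_analysis.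
From mathcomp Require Import lra.
Set Implicit Arguments.
Unset Strict Implicit.
Unset Printing Implicit Defensive.
Import Order.TTheory GRing.Theory Num.Theory.
Import numFieldNormedType.Exports.
Local Open Scope ring_scope.

(** The right-hand side of the theorem is a nested iterated integral.  Writing
f_w(t) for it, the splitting w = u i v, with i the last letter of w from the
first alphabet and v a word over the second one, gives
f_w(t) = <v, Sig(X)_{s,t}> * (integral of f_u(r) dA^i_r over s < r < t).
A product of two iterated integrals is the sum of the iterated integrals over
the shuffles of the two words (integration by parts), so by induction f_w is
a sum of signature coefficients of Y over a multiset of words of length |w|,
namely (B(u) i) shuffled with v, where B(u) is the multiset for u
([block_shuffle], [itint_block_shuffle]).  The map Psi sends a series to the
sums of its coefficients over these multisets.

Psi is invertible because it is unitriangular.  In a shuffle of (p i) with v,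
the word p i v occurs once, and in all the other words part of v comes
before i.  Hence w occurs once in B(w), and all the other words are smaller
for the following order: compare two words of the same length
lexicographically from the last letter on, a letter of the first alphabet
being smaller than a letter of the second ([block_shuffle_head]).  A
unitriangular system with finite rows is solved by back substitution
([unitriangular_bij]).

On the analytic side, a smooth path on an interval containing s and t is
replaced by functions that are continuous on the whole line and equal to the
derivatives of the path on the open interval from s to t
([smooth_on_derive1]).  Integrals then become honest primitives, differentiable
at every point ([is_derive_prim]), and identities between them follow by
comparing derivatives.

All combinatorics is done on reversed words, so that the head of a list is
the outermost integration variable. *)

(** * Unitriangular systems *)

Section Unitriangular.
Variables (T : eqType) (V : zmodType) (lower : T -> seq T) (rank : T -> nat).
Hypothesis lower_rank : forall w p, p \in lower w -> (rank p < rank w)%N.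

Definition unitriangular (a : T -> V) (w : T) : V :=
  a w + \sum_(p <- lower w) a p.

(** The counter [n] bounds the depth of the recursion; the value is meaningful
once it exceeds the rank of [w], and the default 0 is then never reached. *)
Fixpoint back_substitution n (b : T -> V) (w : T) : V :=
  if n is m.+1 then b w - \sum_(p <- lower w) back_substitution m b p else 0.

Lemma back_substitution_stable n m b w : (rank w < n)%N -> (rank w < m)%N ->
  back_substitution n b w = back_substitution m b w.
Proof.
elim: n m w => [//|n IH] [//|m] w /= wn wm; congr (_ - _).
apply: eq_big_seq => p /lower_rank pw.
  by apply: IH; exact: leq_trans pw _.
Qed.

(** The solution of a unitriangular system at [w] only calls for its values at
words of smaller rank, so back substitution terminates; it is an inverse on
both sides by induction on the rank. *)
Lemma unitriangular_bij : bijective unitriangular.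
Proof.
pose g b w := back_substitution (rank w).+1 b w.
have gE b w : g b w = b w - \sum_(p <- lower w) g b p.
  rewrite {1}/g [LHS]/=; congr (_ - _); apply: eq_big_seq => p pw.
  by apply: back_substitution_stable => //; exact: lower_rank.
exists g => a; apply/funext => w; last first.
  by rewrite /unitriangular gE subrK.
have [n wn] := ubnP (rank w); elim: n w wn => // n IH w wn.
rewrite gE {1}/unitriangular.
rewrite [X in _ - X](eq_big_seq a) ?addrK // => p pw.
by apply: IH; rewrite (leq_trans (lower_rank pw)).
Qed.

End Unitriangular.

(** * Shuffles of words and blocks *)

Fixpoint shuffle (T : Type) (v : seq T) : seq T -> seq (seq T) :=
  if v is a :: v' then
    fix shuffle_v (w : seq T) :=
      if w is b :: w' then
        [seq a :: p | p <- shuffle v' w] ++ [seq b :: p | p <- shuffle_v w']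
      else [:: v]
  else fun w => [:: w].

Lemma size_shuffle (T : eqType) (v w q : seq T) :
  q \in shuffle v w -> size q = (size v + size w)%N.
Proof.
elim: v w q => [|a v IHv] w q; first by rewrite inE => /eqP->.
elim: w q => [|b w IHw] q; first by rewrite inE => /eqP->; rewrite addn0.
rewrite /= mem_cat => /orP[] /mapP[p] pin -> /=.
  by rewrite (IHv _ _ pin) /= addSn.
by rewrite (IHw _ pin) /= addnS.
Qed.

Section BlockShuffle.
Variables (L : finType) (A1 : {set L}).
Implicit Types (v r p q : seq L).

(** The multiset B of the words into which the functional of a block word
expands.  The second argument is the part of the reversed word still to be
read; [v] collects the letters outside [A1] read since the last letter in
[A1], all of which have to be shuffled with what comes next. *)
Fixpoint block_shuffle v r : seq (seq L) :=
  if r is x :: r' then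
    if x \in A1 then
      flatten [seq shuffle v (x :: p) | p <- block_shuffle [::] r']
    else block_shuffle (rcons v x) r'
  else [:: v].

(** The binary number whose digit is 1 at the letters outside [A1], the head
being the most significant digit: a numerical form of the lexicographic
order. *)
Fixpoint weight r : nat :=
  if r is x :: r' then ((x \notin A1) * 2 ^ size r' + weight r')%N else 0.

Lemma weight_lt r : (weight r < 2 ^ size r)%N.
Proof.
elim: r => //= x r IH; rewrite expnS mul2n -addnn -addnS leq_add//.
by case: (x \in A1); rewrite ?mul0n ?mul1n.
Qed.

Lemma weight_cat_lt v r r' : size r = size r' -> (weight r < weight r')%N ->
  (weight (v ++ r) < weight (v ++ r'))%N.
Proof.
by move=> rr' wr; elim: v => //= x v IH; rewrite !size_cat rr' ltn_add2l.
Qed.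

(** Any shuffle other than the concatenation has [x] in front of some letter of
[v], so the first digit where the two weights differ is smaller in the
shuffle. *)
Lemma shuffle_head x v p : x \in A1 -> all [pred y | y \notin A1] v ->
  exists2 l, shuffle v (x :: p) = (v ++ x :: p) :: l
    & {in l, forall q, (weight q < weight (v ++ x :: p))%N}.
Proof.
move=> xA1; elim: v => [|y v IH] /=; first by exists [::].
move=> /andP[yA1 /IH[l e lw]]; rewrite e; eexists; first by [].
move=> q; rewrite mem_cat => /orP[] /mapP[q' q'in -> /=]; rewrite yA1 !mul1n.
  have /size_shuffle -> : q' \in shuffle v (x :: p) by rewrite e inE q'in orbT.
  by rewrite size_cat ltn_add2l lw.
rewrite xA1 mul0n add0n (leq_trans (weight_lt q'))//.
have /size_shuffle -> : q' \in shuffle (y :: v) p by [].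
by rewrite size_cat /= addnS addSn leq_addr.
Qed.

(** The leading word comes from the leading word of the recursive call and the trivial shuffle.  Every other word either is a nontrivial shuffle
of the leading word, or comes from a smaller word, and prepending the same
letters to words of the same length preserves the order of the weights. *)
Lemma block_shuffle_head v r : all [pred y | y \notin A1] v ->
  exists2 l, block_shuffle v r = (v ++ r) :: l
    & {in l, forall q, size q = size (v ++ r) /\ (weight q < weight (v ++ r))%N}.
Proof.
elim: r v => [|x r IH] v vA1 /=; first by exists [::]; rewrite ?cats0.
have [xA1|xA1] := ifP; last first.
  rewrite -cat_rcons; apply: IH; by rewrite all_rcons /= xA1.
have [l0 -> l0w] := IH [::] isT.
have [l1 e1 l1w] := shuffle_head r xA1 vA1.
rewrite /= e1 cat_cons; eexists; first by [].
move=> q; rewrite mem_cat => /orP[ql1|/flatten_mapP[p pl0 qp]].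
  split; last exact: l1w.
  rewrite size_cat; apply: size_shuffle; by rewrite e1 inE ql1 orbT.
have /= [sp wp] := l0w _ pl0; split.
  by rewrite (size_shuffle qp) size_cat /= sp.
have lt : (weight (v ++ x :: p) < weight (v ++ x :: r))%N.
  by apply: weight_cat_lt => /=; rewrite sp ?ltn_add2l.
have [l2 e2 l2w] := shuffle_head p xA1 vA1.
move: qp; rewrite e2 inE => /predU1P[->//|/l2w ql2].
exact: ltn_trans lt.
Qed.

Lemma block_shuffle_cat v u r : all [pred y | y \notin A1] u ->
  block_shuffle v (u ++ r) = block_shuffle (v ++ u) r.
Proof.
elim: u v => [|x u IH] v /=; first by rewrite cats0.
by move=> /andP[/negbTE -> /IH ->]; rewrite cat_rcons.
Qed.

End BlockShuffle.

(** * The linear map on series *)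

Section Psi.
Variables (R : realType) (L : finType) (A1 : {set L}).

Definition Psi (a : tensor_series R L) : tensor_series R L :=
  fun w => \sum_(p <- block_shuffle A1 [::] (rev w)) a (rev p).

Fact Psi_linear : linear Psi.
Proof.
move=> k a b; apply/funext => w; rewrite /Psi /= !fctE scaler_sumr -big_split.
by [].
Qed.

HB.instance Definition _ := GRing.isLinear.Build R (tensor_series R L)
  (tensor_series R L) *:%R Psi Psi_linear.

(** Turns a sum over a multiset of words into the sum with coefficients that
[graded] asks for, the coefficients being multiplicities. *)
Lemma big_seq_tuple n (s : seq (seq L)) (f : seq L -> R) :
  {in s, forall p, size p = n} ->
  \sum_(p <- s) f p = \sum_(v : n.-tuple L) (count_mem (val v) s)%:R * f v.
Proof.
elim: s => [|p s IH] sn.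
  by rewrite big_nil big1// => v _; rewrite mul0r.
rewrite big_cons IH; last by move=> q qs; apply: sn; rewrite inE qs orbT.
under [RHS]eq_bigr do rewrite /= natrD mulrDl.
rewrite big_split /=; congr (_ + _).
have pn : size p == n by apply/eqP/sn; rewrite inE eqxx.
rewrite (bigD1 (Tuple pn)) //= eqxx mul1r big1 ?addr0// => v.
by rewrite -val_eqE /= eq_sym => /negbTE ->; rewrite mul0r.
Qed.

Lemma Psi_graded : graded Psi.
Proof.
exists (fun w v => (count_mem v (map rev (block_shuffle A1 [::] (rev w))))%:R).
move=> a w; rewrite -big_seq_tuple; first by rewrite big_map.
move=> _ /mapP[p pin ->]; rewrite size_rev.
have [l e lw] := @block_shuffle_head L A1 [::] (rev w) isT.
move: pin; rewrite e inE => /predU1P[->|/lw[-> _]]; exact: size_rev.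
Qed.

Lemma Psi_bij : bijective Psi.
Proof.
pose lower w := map rev (behead (block_shuffle A1 [::] (rev w))).
have -> : Psi = unitriangular lower.
  apply/funext => a; apply/funext => w; rewrite /unitriangular /lower /Psi.
  have [l -> _] := @block_shuffle_head L A1 [::] (rev w) isT.
  by rewrite big_cons big_map revK.
apply: (@unitriangular_bij _ _ _ (weight A1 \o rev)) => w _ /mapP[p + ->] /=.
have [l -> lw] := @block_shuffle_head L A1 [::] (rev w) isT.
by rewrite revK => /lw[].
Qed.
End Psi.

(** * Primitives of continuous functions *)

Section Primitive.
Variable R : realType.
Implicit Types (f g F G : R -> R) (s t u x : R).
Local Notation mu := (@lebesgue_measure R).

(** The oriented integral from [s] to [u]: one of the two terms is an integral
over an empty set.  Allowing [u < s] makes [prim s f] a primitive of [f] on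
the whole line, with no special case at [s]. *)
Definition prim s f u : R :=
  \int[mu]_(r in `]s, u]%classic) f r - \int[mu]_(r in `]u, s]%classic) f r.

Lemma integrable_itv f s u : continuous f ->
  mu.-integrable `]s, u]%classic (EFin \o f).
Proof.
move=> fc; apply: (@integrableS _ _ _ mu `[s, u]%classic) => //.
  exact: subset_itv_oc_cc.
apply: continuous_compact_integrable; first exact: segment_compact.
exact: continuous_subspaceT.
Qed.

Lemma prim_shift f a s u : continuous f -> a <= s -> a <= u ->
  prim s f u =
  \int[mu]_(r in `]a, u]%classic) f r - \int[mu]_(r in `]a, s]%classic) f r.
Proof.
move=> fc as_ au; rewrite /prim.
have [su|/ltW us] := leP s u.
  rewrite [in X in _ - X]set_itv_ge ?bnd_simp -?leNgt// Rintegral_set0 subr0.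
  by rewrite Rintegral_itvB ?bnd_simp//; exact: integrable_itv.
rewrite [in X in X - _]set_itv_ge ?bnd_simp -?leNgt// Rintegral_set0 sub0r.
rewrite -[RHS]opprB; congr (- _).
by rewrite Rintegral_itvB ?bnd_simp//; exact: integrable_itv.
Qed.

Lemma prim0 s f : prim s f s = 0.
Proof. by rewrite /prim subrr. Qed.

Lemma prim_ge s f u : continuous f -> s <= u ->
  prim s f u = \int[mu]_(r in `]s, u[%classic) f r.
Proof.
move=> fc su; rewrite /prim.
rewrite [in X in _ - X]set_itv_ge ?bnd_simp -?leNgt// Rintegral_set0 subr0.
rewrite Rintegral_itv_bndo_bndc//.
by apply: integrableS (integrable_itv s u fc) => //; exact: subset_itv_oo_oc.
Qed.

(** By [prim_shift], near [x] the oriented integral is, up to a constant, an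
integral with a fixed lower end [a] to the left of both [s] and [x]; the
fundamental theorem of calculus applies to the latter. *)
Lemma is_derive_prim s f x : continuous f -> is_derive x 1 (prim s f) (f x).
Proof.
move=> fc; pose a := Num.min s x - 1.
have as_ : a < s by rewrite ltrBlDr (@le_lt_trans _ _ s) ?ge_min ?lexx// ltrDl.
have ax : a < x by rewrite ltrBlDr (@le_lt_trans _ _ x) ?ge_min ?lexx ?orbT// ltrDl.
pose F y := (\int[mu]_(r in `]a, y]%classic) f r)%R.
have [dF F'] : derivable F x 1 /\ derive1 F x = f x.
  apply: (@continuous_FTC1 _ f (BRight a) x (x + 1)).
  - by rewrite ltrDl.
  - exact: integrable_itv.
  - by [].
  - exact: fc.
have HF : is_derive x 1 (fun y => F y - F s) (f x).
  have -> : f x = f x - 0 by rewrite subr0.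
  apply: is_deriveB; rewrite -F' derive1E; exact: derivableP.
apply: near_eq_is_derive HF.
near=> y; rewrite -(@prim_shift f a)//; first exact: ltW.
apply: ltW; near: y; exact: lt_nbhsr.
Unshelve. all: by end_near. Qed.

Lemma continuous_prim s f : continuous f -> continuous (prim s f).
Proof.
move=> fc x; apply: differentiable_continuous; apply/derivable1_diffP.
by have [] := @is_derive_prim s f x fc.
Qed.

Lemma prim_unique s f F : continuous f -> F s = 0 ->
  (forall x, is_derive x 1 F (f x)) -> F =1 prim s f.
Proof.
move=> fc F0 dF u; apply/eqP; rewrite -subr_eq0; apply/eqP.
rewrite (_ : 0 = F s - prim s f s); last by rewrite F0 prim0 subr0.
apply: (@is_derive_0_is_cst _ (F \- prim s f)) => x.
rewrite -[0](subrr (f x)); apply: is_deriveB; exact: is_derive_prim.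
Qed.

Lemma prim_sum (I : Type) (r : seq I) (f : I -> R -> R) s u :
  (forall i, continuous (f i)) ->
  \sum_(i <- r) prim s (f i) u = prim s (fun x => \sum_(i <- r) f i x) u.
Proof.
move=> fc; apply: (@prim_unique s _ (fun x => \sum_(i <- r) prim s (f i) x)).
- apply: continuous_big => [|i _]; [exact: add_continuous|exact: fc].
- by rewrite big1// => i _; rewrite prim0.
move=> x; elim: r => [|i r IH].
  rewrite big_nil; under eq_fun do rewrite big_nil; exact: is_derive_cst.
rewrite big_cons; under eq_fun do rewrite big_cons.
by apply: is_deriveD; exact: is_derive_prim.
Qed.

(** Integration by parts: the shuffle relation in its simplest form. *)
Lemma prim_mul s f g u : continuous f -> continuous g ->
  prim s f u * prim s g u =
  prim s (fun x => f x * prim s g x) u + prim s (fun x => prim s f x * g x) u.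
Proof.
move=> fc gc; apply/eqP; rewrite addrC -subr_eq; apply/eqP.
have Pf := @continuous_prim s f fc; have Pg := @continuous_prim s g gc.
have fPg : continuous (fun x => f x * prim s g x).
  by move=> x; apply: cvgM; [exact: fc|exact: Pg].
apply: (@prim_unique s _ (fun x => prim s f x * prim s g x
  - prim s (fun x => f x * prim s g x) x)).
- by move=> x; apply: cvgM; [exact: Pf|exact: gc].
- by rewrite !prim0 mul0r subr0.
move=> x; have df := @is_derive_prim s f x fc.
have dg := @is_derive_prim s g x gc.
have dfg := @is_derive_prim s _ x fPg.
apply: is_derive_eq; rewrite /GRing.scale /= (mulrC (prim s g x)).
by rewrite addrK.
Qed.

End Primitive.

(** * Iterated integrals *)

Section Iterated.
Variables (R : realType) (T : Type) (y : T -> R -> R) (s : R).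
Hypothesis yc : forall a, continuous (y a).

(** The head of the word belongs to the outermost variable. *)
Fixpoint itint (w : seq T) : R -> R :=
  if w is a :: w' then prim s (fun r => itint w' r * y a r) else fun=> 1.

Lemma continuous_itint w : continuous (itint w).
Proof.
elim: w => [|a w IH] /=; first exact: cst_continuous.
by apply: continuous_prim => x; apply: cvgM; [exact: IH|exact: yc].
Qed.

Lemma continuous_itintM w a : continuous (fun r => itint w r * y a r).
Proof. by move=> x; apply: cvgM; [exact: continuous_itint|exact: yc]. Qed.

(** Integrating by parts, the outermost variable of the product is that of one
of the two factors, which is the recursion that defines the shuffles. *)
Lemma itint_shuffle v w u :
  itint v u * itint w u = \sum_(p <- shuffle v w) itint p u.
Proof.
elim: v w u => [|a v IHv] w u; first by rewrite big_seq1 /= mul1r.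
elim: w u => [|b w IHw] u; first by rewrite big_seq1 mulr1.
rewrite /= big_cat !big_map /= !prim_sum;
  try by move=> p; exact: continuous_itintM.
rewrite prim_mul; try exact: continuous_itintM.
congr (prim s _ u + prim s _ u); apply/funext => r.
  by rewrite -mulr_suml -IHv mulrAC.
by rewrite -mulr_suml -IHw mulrA.
Qed.

Lemma eq_simplex_integral n t u (G H : seq R -> R) :
  (forall ts, size ts = n -> G ts = H ts) ->
  simplex_integral n t u G = simplex_integral n t u H.
Proof.
elim: n u G H => [|n IH] u G H GH /=; first exact: GH.
apply: eq_Rintegral => r _; apply: IH => ts ts_n.
by apply: GH; rewrite size_rcons ts_n.
Qed.

(** The factor [c] makes the induction work: integrating out the last variable
leaves its integrand as a constant factor for the inner integrals.  The
integrals run over open intervals, so agreement of [f] and [y] on the open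
interval is enough. *)
Lemma simplex_integral_itint t (f : T -> R -> R) w c u :
  (forall a, {in `]s, t[, f a =1 y a}) -> s <= u <= t ->
  simplex_integral (size w) s u (fun ts => (\prod_(q <- zip w ts) f q.1 q.2) * c)
  = itint (rev w) u * c.
Proof.
move=> fy; elim/last_ind: w c u => [|w a IH] c u /andP[su ut].
  by rewrite /= big_nil.
rewrite size_rcons rev_rcons /=.
transitivity (\int[lebesgue_measure]_(r in `]s, u[%classic)
    (itint (rev w) r * y a r * c)).
  apply: eq_Rintegral => r; rewrite inE /= in_itv /= => /andP[sr ru].
  rewrite -mulrA -fy ?in_itv /= ?sr ?(lt_le_trans ru)//.
  rewrite -IH; last by rewrite (ltW sr) (le_trans (ltW ru)).
  apply: eq_simplex_integral => ts ts_n.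
  by rewrite zip_rcons // big_rcons /= -mulrA.
have fc := @continuous_itintM (rev w) a.
rewrite RintegralZr//; first by rewrite prim_ge.
by apply: integrableS (integrable_itv s u fc) => //; exact: subset_itv_oo_oc.
Qed.
End Iterated.

(** * Velocities of smooth paths *)

Section Smooth.
Variable R : realType.
Implicit Types (I : interval R) (f : R -> R).

(** The first derivative inside [I] is continuous on [I]; composing it with the
retraction of the line onto the segment from [s] to [t] extends it
continuously.  At the ends of the segment the two-sided derivative of [f] may
not be the one-sided one, hence the open interval. *)
Lemma smooth_on_derive1 I f (s t : R) : smooth_on I f ->
  s \in I -> t \in I -> s < t ->
  exists2 g, continuous g & {in `]s, t[, derive1 f =1 g}.
Proof.
move=> [F [F0 dF]] sI tI st.
have sub x : s <= x <= t -> x \in I.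
  by exact: (@interval_is_interval _ I s t sI tI x).
pose c x := Num.max s (Num.min t x).
have cI x : c x \in I.
  by apply: sub; rewrite /c le_max lexx /= ge_max (ltW st) ge_min lexx.
have c1 x z : `|c x - c z| <= `|x - z|.
  have h1 := ler_norm (x - z); have h2 := ler_norm (z - x).
  rewrite distrC in h2; rewrite ler_norml /c /Num.max /Num.min.
  by case: (ltP t x) => ?; case: (ltP t z) => ?; apply/andP; split;
    do !case: ltP => ?; lra.
exists (F 1%N \o c).
  (* A bounded difference quotient at z makes F 1 Lipschitz at z within I. *)
  move=> x; set z := c x.
  have /cvgrPdist_lt /(_ 1 ltr01) := dF 1%N z (cI x).
  rewrite !near_withinE => /nbhs_ballP[d /= d0 Hd].
  pose K := `|F 2%N z| + 1.
  have K0 : 0 < K by rewrite ltr_wpDl.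
  have FK v : v \in I -> `|v - z| < d -> `|F 1%N v - F 1%N z| <= K * `|v - z|.
    move=> vI vd; have [->|vz] := eqVneq v z.
      by rewrite !subrr normr0 mulr0.
    have := Hd v; rewrite /ball /= distrC => /(_ vd vz vI) /ltW q1.
    have vz0 : v - z != 0 by rewrite subr_eq0.
    rewrite -ler_pdivrMr ?normr_gt0// -normf_div /K -lerBlDl.
    by rewrite (le_trans _ q1)// distrC lerB_dist.
  apply/cvgrPdist_lt => e e0 /=; near=> v.
  have vx : `|x - v| < d by near: v; exact: cvgr_dist_lt.
  have cv : `|c v - z| <= `|x - v| by rewrite (distrC x) c1.
  rewrite distrC (le_lt_trans (FK _ (cI v) _))//; first exact: le_lt_trans vx.
  rewrite (le_lt_trans (ler_wpM2l (ltW K0) cv))// -ltr_pdivlMl//.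
  near: v; apply: cvgr_dist_lt => //; by rewrite mulr_gt0 ?invr_gt0.
move=> x xst /=.
have cx : c x = x.
  by move: xst; rewrite in_itv /= => /andP[sx xt]; rewrite /c min_r ?max_r// ltW.
rewrite cx.
have xI : x \in I by rewrite -cx.
rewrite /derive1; apply/cvg_lim => //.
apply/cvgrPdist_lt => e e0.
have /cvgrPdist_lt /(_ e e0) := dF 0%N x xI.
rewrite !near_withinE => /nbhs_ballP[d /= d0 Hd].
apply/nbhs_ballP.
have := near_in_itvoo xst.
move=> /nbhs_ballP[d' /= d'0 Hd'].
exists (Num.min d d') => /=; first by rewrite lt_min d0.
move=> h; rewrite /ball /= sub0r normrN lt_min => /andP[hd hd'] h0.
have := Hd (h + x); have := Hd' (h + x).
rewrite /ball /= opprD addrCA subrr addr0 normrN => /(_ hd') hst /(_ hd).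
have hI : h + x \in I.
  by apply: sub; move: hst; rewrite in_itv /= => /andP[/ltW-> /ltW->].
rewrite addrK -subr_eq0 addrK => /(_ h0 hI).
by rewrite !F0 //= mulrC.
Unshelve. all: by end_near. Qed.

End Smooth.

(** * Evaluation on signatures *)

Section Evaluation.
Variables (R : realType) (L : finType) (A1 A2 : {set L}).
Hypothesis dis : [disjoint A1 & A2].
Variables (y : L -> R -> R) (s : R).
Hypothesis yc : forall a, continuous (y a).
Local Notation block := (seq {x | x \in A2} * {x | x \in A1})%type.

(** With whole blocks as letters, the integral on the right-hand side of the
theorem is the iterated integral of these velocities. *)
Definition block_velocity (b : block) (r : R) : R :=
  itint y s (rev (map val b.1)) r * y (val b.2) r.

Lemma continuous_block_velocity b : continuous (block_velocity b).
Proof.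
by move=> x; apply: cvgM; [exact: continuous_itint|exact: yc].
Qed.

Lemma block_word_rcons (bs : seq block) u i wk :
  block_word (rcons bs (u, i)) wk = rcons (block_word bs u) (val i) ++ map val wk.
Proof.
by rewrite /block_word map_rcons flatten_rcons -!cats1 -!catA.
Qed.

(** Induction on the number of blocks: the shuffles with the last word [wk] sum
to a product by [itint_shuffle], and the last letter in [A1] integrates the sum
given by the induction hypothesis. *)
Lemma itint_block_shuffle (bs : seq block) wk t :
  \sum_(p <- block_shuffle A1 [::] (rev (block_word bs wk))) itint y s p t =
  itint y s (rev (map val wk)) t * itint block_velocity s (rev bs) t.
Proof.
have A2P (u : seq {x | x \in A2}) : all [pred x | x \notin A1] (rev (map val u)).
  rewrite all_rev all_map; apply/allP => x _ /=.
  by rewrite (disjointFl dis (valP x)).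
elim/last_ind: bs wk t => [|bs [u i] IH] wk t.
  rewrite /block_word /= -[rev (map _ _)]cats0 block_shuffle_cat// big_seq1.
  by rewrite cats0 mulr1.
rewrite block_word_rcons rev_cat rev_rcons block_shuffle_cat//= (valP i).
rewrite big_flatten big_map rev_rcons /=.
under eq_bigr do rewrite -itint_shuffle//.
rewrite -mulr_sumr /= prim_sum; last by move=> p; exact: continuous_itintM.
congr (_ * prim s _ t); apply/funext => r.
by rewrite -mulr_suml IH /block_velocity /= mulrAC mulrC mulrA.
Qed.
End Evaluation.

Theorem theorem1p1 (R : realType) (L : finType) (A1 A2 : {set L})
    (hcover : A1 :|: A2 = [set: L]) (hdisj : [disjoint A1 & A2])
    (hA1 : A1 != finset.set0) (hA2 : A2 != finset.set0) :
  exists Psi : {linear tensor_series R L -> tensor_series R L},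
    [/\ graded Psi, bijective Psi &
      forall (I : interval R) (Y : L -> R -> R),
        (forall a, smooth_on I (Y a)) ->
        let A := fun i : {x | x \in A1} => Y (val i) in
        let X := fun b : {x | x \in A2} => Y (val b) in
        forall s t : R, s \in I -> t \in I -> s < t ->
        forall (w : seq L) (bs : seq (seq {x | x \in A2} * {x | x \in A1}))
               (wk : seq {x | x \in A2}),
          w = block_word bs wk ->
          Psi (Sig Y s t) w =
            Sig X s t wk *
            simplex_integral (size bs) s t (fun ts =>
              \prod_(q <- zip bs ts)
                 (Sig X s q.2 q.1.1 * derive1 (A q.1.2) q.2))].
Proof.
exists (Psi A1 : {linear tensor_series R L -> tensor_series R L}).
split; [exact: Psi_graded|exact: Psi_bij|].
move=> I Y Ysm A X s t sI tI st _ bs wk ->.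
have /choice[y yP] a : exists g,
    continuous g /\ {in `]s, t[, derive1 (Y a) =1 g}.
  by have [g ? ?] := smooth_on_derive1 (Ysm a) sI tI st; exists g.
have yc a : continuous (y a) := (yP a).1.
have Yy a : {in `]s, t[, derive1 (Y a) =1 y a} := (yP a).2.
have simplexE (T : Type) (f g : T -> R -> R) w u :
    (forall a, continuous (g a)) -> (forall a, {in `]s, t[, f a =1 g a}) ->
    s <= u <= t ->
    simplex_integral (size w) s u (fun ts => \prod_(q <- zip w ts) f q.1 q.2)
    = itint g s (rev w) u.
  move=> gc fg su; rewrite -[RHS]mulr1 -(simplex_integral_itint gc _ _ fg su).
  by apply: eq_simplex_integral => ts _; rewrite mulr1.
have sigX u v : s <= u <= t -> Sig X s u v = itint y s (rev (map val v)) u.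
  move=> su; rewrite /Sig (simplexE _ (fun b => derive1 (X b))
    (fun b => y (val b)))//;
    last by move=> b; exact: Yy.
  rewrite -map_rev; elim: (rev v) {su} u => //= b v' IH u.
  by congr prim; apply/funext => r; rewrite IH.
have tt : s <= t <= t by rewrite lexx ltW.
transitivity (\sum_(p <- block_shuffle A1 [::] (rev (block_word bs wk)))
    itint y s p t).
  apply: eq_bigr => p _.
  by rewrite /Sig (simplexE _ (fun a => derive1 (Y a)) y)// revK.
rewrite itint_block_shuffle// sigX//; congr (_ * _).
rewrite (simplexE _ (fun b r => Sig X s r b.1 * derive1 (A b.2) r)
  (block_velocity y s))//.
  exact: continuous_block_velocity.
move=> b r rst; rewrite Yy// sigX//.
by move: rst; rewrite in_itv /= => /andP[/ltW -> /ltW ->].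
Qed.
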